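(* There exists an absolute constant $C>0$ and an algorithm with the following guarantee. Let $k\ge2$, $n\ge1$, $\varepsilon\in(0,1]$, and let $P$ be a distribution on $[n]$ with $\mathrm{d_{TV}}(P,U_n)\ge\varepsilon$. Given $n,k,\varepsilon$, sample access to $P$, and sample access to distributions $D_1,\dots,D_k$ on $[n]$ each promised to be equal to $P$ or to $U_n$, the algorithm correctly classifies every $D_i$ as $P$ or $U_n$ with probability at least $8/9$, using in total (including samples from $P$) at most $C\frac{\sqrt{nk\log k}}{\varepsilon^2}$ samples if $n\ge k\log k$, and at most $C\frac{k\log k}{\varepsilon^2}$ samples if $n\le k\log k$.
   Context: $U_n$ is the uniform distribution on $[n]$; $\mathrm{d_{TV}}$ is total variation distance. Sample access means the algorithm may adaptively request independent samples from the distribution. *)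

(* Defs.v *)
From HB Require Import structures.
From mathcomp Require Import all_boot all_order all_algebra.
From Stdlib Require Import Rdefinitions Rpower R_sqrt.
From mathcomp Require Import Rstruct.
Set Implicit Arguments. Unset Strict Implicit. Unset Printing Implicit Defensive.
Import Order.TTheory GRing.Theory Num.Theory.
Local Open Scope ring_scope.

Notation R := Rdefinitions.R.

Definition is_distr (n : nat) (D : 'I_n -> R) : Prop :=
  (forall x, 0 <= D x) /\ \sum_(x < n) D x = 1.

Definition unif (n : nat) : 'I_n -> R := fun _ => n%:R^-1.
Arguments unif n : clear implicits.

Definition dTV (n : nat) (D1 D2 : 'I_n -> R) : R :=
  2^-1 * \sum_(x < n) `|D1 x - D2 x|.

(* A randomized adaptive sampling algorithm, as a (finite-path) decision tree.
   Sources are indexed by 'I_k.+1: index 0 is P, index i.+1 is D_(i+1).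
   - [Output f]     : stop and output f i = true meaning "D_i is P",
                      f i = false meaning "D_i is U_n";
   - [Sample j c]   : draw one fresh independent sample x from source j,
                      continue with c x;
   - [Flip c]       : flip a fair internal coin b, continue with c b. *)
Inductive alg (n k : nat) : Type :=
| Output of ('I_k -> bool)
| Sample of 'I_k.+1 & ('I_n -> alg n k)
| Flip of (bool -> alg n k).

Arguments Output {n k}.
Arguments Sample {n k}.
Arguments Flip {n k}.

Fixpoint succ_prob (n k : nat) (t : alg n k) (src : 'I_k.+1 -> 'I_n -> R)
    (good : ('I_k -> bool) -> bool) : R :=
  match t with
  | Output f => if good f then 1 else 0
  | Sample j c => \sum_(x < n) src j x * succ_prob (c x) src good
  | Flip c => 2^-1 * (succ_prob (c true) src good + succ_prob (c false) src good)
  end.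

Fixpoint nsamples (n k : nat) (t : alg n k) : nat :=
  match t with
  | Output _ => 0%N
  | Sample _ c => (\max_(x < n) nsamples (c x)).+1
  | Flip c => maxn (nsamples (c true)) (nsamples (c false))
  end.

Definition sources (n k : nat) (P : 'I_n -> R) (b : 'I_k -> bool)
    : 'I_k.+1 -> 'I_n -> R :=
  fun j => match unlift ord0 j with
           | None => P
           | Some i => if b i then P else unif n
           end.

Definition correct (k : nat) (b : 'I_k -> bool) (f : 'I_k -> bool) : bool :=
  [forall i, f i == b i].

Definition bound (C : R) (n k : nat) (eps : R) : R :=
  let klogk := k%:R * ln k%:R in
  if klogk <= n%:R then C * sqrt (n%:R * klogk) / eps ^+ 2
  else C * klogk / eps ^+ 2.

(* Main.v *)
Require Import Defs.
From HB Require Import structures.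
From mathcomp Require Import all_boot all_order all_algebra.
From Stdlib Require Import Rdefinitions Rpower R_sqrt.
From mathcomp Require Import Rstruct.
From mathcomp Require Import ring lra zify.
Import Order.TTheory GRing.Theory Num.Theory.
Local Open Scope ring_scope.

Set Implicit Arguments.
Unset Strict Implicit.
Unset Printing Implicit Defensive.

(* Stdlib captures the scope keys N and R and binds [R] to [R_scope]. *)
Delimit Scope nat_scope with N.
Delimit Scope ring_scope with R.
Bind Scope ring_scope with Rdefinitions.R.

(** Split the samples of [P] into [r] groups of [t <= (n+1)/2] samples and let
    [f x] be the number of groups that contain [x]. If [hit t p = 1 - (1-p)^t] is
    the probability that a group hits a point of mass [p], then the gap
    [<f, P - U_n>] has mean
    [r * sum_x (P x - 1/n) (hit t (P x) - hit t (1/n))], whose terms are all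
    nonnegative; since [hit t] is concave, the points with [P x < 1/n] alone
    contribute [r t eps^2 / (2 n)]. Concavity and the negative correlation of the
    hitting events bound the variance of the gap by [4 / t] times its mean, so the
    gap is large with high probability; since [hit t] is [t]-Lipschitz and bounded
    by 1, the variances of [f] under [P] and under [U_n] are controlled by the same
    mean, so heavy points of [P] cause no trouble. Hence blocks of
    [m ~ sqrt (n / (k log k)) / eps^2 + 1 / eps^2] samples of [D_i] suffice to
    classify [D_i] with constant error, by comparing the empirical mean of [f] with
    its mean under [U_n]; a majority vote over [O(log k)] blocks brings the error
    below [1 / (18 k)], and the learned function [f] is shared by all the [D_i]. *)

(** * Means as positive linear functionals *)

Record is_mean (K : realFieldType) (T : Type) (e : (T -> K) -> K) : Prop := IsMean {
  is_mean_linear : forall a F G, e (fun x => a * F x + G x) = a * e F + e G;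
  is_mean_le : forall F G, (forall x, F x <= G x) -> e F <= e G;
  is_mean1 : e (fun=> 1) = 1 }.

Record mean (K : realFieldType) (T : Type) := Mean {
  mean_fun :> (T -> K) -> K;
  meanP : is_mean mean_fun }.

Section MeanFunctionals.
Variables (K : realFieldType) (T : Type).
Implicit Types (e : (T -> K) -> K) (F G : T -> K) (A : pred T).

Definition prob e A : K := e (fun x => (A x)%:R).

Definition covariance e F G : K := e (fun x => (F x - e F) * (G x - e G)).

Definition variance e F : K := e (fun x => (F x - e F) ^+ 2).

End MeanFunctionals.

Section Mean.
Variables (K : realFieldType) (T : Type) (e : mean K T).
Implicit Types (F G : T -> K) (A B : pred T) (a c : K).

Lemma le_mean F G : (forall x, F x <= G x) -> e F <= e G.
Proof. exact: is_mean_le (meanP e) _ _. Qed.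

Lemma eq_mean F G : (forall x, F x = G x) -> e F = e G.
Proof. by move=> FG; apply/le_anti; rewrite !le_mean // => x; rewrite FG. Qed.

Lemma mean_linear a F G : e (fun x => a * F x + G x) = a * e F + e G.
Proof. exact: is_mean_linear (meanP e) _ _ _. Qed.

Lemma meanD F G : e (fun x => F x + G x) = e F + e G.
Proof. by rewrite -[e F]mul1r -mean_linear; apply: eq_mean => x; rewrite mul1r. Qed.

Lemma mean0 : e (fun=> 0) = 0.
Proof.
apply: (addrI (e (fun=> 0))); rewrite addr0 -meanD.
by apply: eq_mean => x; rewrite addr0.
Qed.

Lemma meanZ a F : e (fun x => a * F x) = a * e F.
Proof.
by rewrite -[RHS]addr0 -mean0 -mean_linear; apply: eq_mean => x; rewrite addr0.
Qed.

Lemma mean_cst a : e (fun=> a) = a.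
Proof.
by rewrite -[RHS]mulr1 -(is_mean1 (meanP e)) -meanZ; apply: eq_mean => x; rewrite mulr1.
Qed.

Lemma meanB F G : e (fun x => F x - G x) = e F - e G.
Proof. by rewrite -mulN1r -meanZ -meanD; apply: eq_mean => x; rewrite mulN1r. Qed.

Lemma mean_sum (I : Type) (s : seq I) (F : I -> T -> K) :
  e (fun x => \sum_(i <- s) F i x) = \sum_(i <- s) e (F i).
Proof.
elim: s => [|i s IHs].
  by rewrite big_nil -[RHS]mean0; apply: eq_mean => x; rewrite big_nil.
by rewrite big_cons -IHs -meanD; apply: eq_mean => x; rewrite big_cons.
Qed.

Lemma mean_ge0 F : (forall x, 0 <= F x) -> 0 <= e F.
Proof. by move=> F_ge0; rewrite -mean0; apply: le_mean. Qed.

Lemma le_prob A B : (forall x, A x -> B x) -> prob e A <= prob e B.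
Proof.
by move=> AB; apply: le_mean => x; rewrite ler_nat; case: (A x) (AB x) => // ->.
Qed.

Lemma probC A : prob e (predC A) = 1 - prob e A.
Proof.
rewrite /prob -[X in X - _](mean_cst 1) -meanB; apply: eq_mean => x /=.
by case: (A x); rewrite ?subrr ?subr0.
Qed.

Lemma probU_le A B : prob e (predU A B) <= prob e A + prob e B.
Proof.
rewrite -meanD; apply: le_mean => x /=; rewrite -natrD ler_nat.
by case: (A x); case: (B x).
Qed.

Lemma prob_exists_le (I : finType) (A : I -> pred T) :
  prob e (fun x => [exists i, A i x]) <= \sum_i prob e (A i).
Proof.
rewrite -mean_sum; apply: le_mean => x; rewrite -natr_sum ler_nat.
by case: existsP => // -[i Aix]; rewrite (bigD1 i) //= Aix.
Qed.

Lemma mean_ge_subprobC F A c : c <= 1 -> (forall x, 0 <= F x) ->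
  (forall x, A x -> c <= F x) -> c - prob e (predC A) <= e F.
Proof.
move=> c1 F0 AF; rewrite -[X in X - _](mean_cst c) -meanB; apply: le_mean => x /=.
by case: (A x) (AF x) (F0 x) => /= [/(_ isT)|_]; lra.
Qed.

Lemma prob_markov F a : 0 < a -> (forall x, 0 <= F x) ->
  prob e (fun x => a <= F x) <= e F / a.
Proof.
move=> a0 F0; rewrite mulrC -meanZ; apply: le_mean => x.
case: (leP a (F x)) => aF /=; last by rewrite mulr_ge0 // invr_ge0 ltW.
by rewrite ler_pdivlMl // mulr1.
Qed.

Lemma mean_sqr_subr F c : e (fun x => (F x - c) ^+ 2) = variance e F + (e F - c) ^+ 2.
Proof.
have -> : e (fun x => (F x - c) ^+ 2) = e (fun x => (F x - e F) ^+ 2 +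
    (2 * (e F - c) * F x + ((e F - c) ^+ 2 - 2 * (e F - c) * e F))).
  by apply: eq_mean => x; rewrite !expr2; ring.
by rewrite meanD mean_linear mean_cst -/(variance e F) !expr2; ring.
Qed.

Lemma variance_ge0 F : 0 <= variance e F.
Proof. by apply: mean_ge0 => x; apply: sqr_ge0. Qed.

Lemma variance_le_mean_sqr_subr F c : variance e F <= e (fun x => (F x - c) ^+ 2).
Proof. by rewrite mean_sqr_subr lerDl sqr_ge0. Qed.

Lemma mean_sqr F : e (fun x => F x ^+ 2) = variance e F + e F ^+ 2.
Proof.
by rewrite -[e F in RHS]subr0 -mean_sqr_subr; apply: eq_mean => x; rewrite subr0.
Qed.

Lemma sqr_mean_le F : e F ^+ 2 <= e (fun x => F x ^+ 2).
Proof. by rewrite mean_sqr lerDr variance_ge0. Qed.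

Lemma variance_indicator A : variance e (fun x => (A x)%:R) = prob e A * (1 - prob e A).
Proof.
apply: (addIr (prob e A ^+ 2)); rewrite -mean_sqr.
rewrite (eq_mean (G := fun x => (A x)%:R)); first by rewrite -/(prob e A) expr2; ring.
by move=> x; case: (A x); rewrite expr2 ?mulr1 ?mulr0.
Qed.

Lemma eq_variance F G : (forall x, F x = G x) -> variance e F = variance e G.
Proof.
by move=> FG; rewrite /variance (eq_mean FG); apply: eq_mean => x; rewrite FG.
Qed.

Lemma eq_covariance F F' G G' : (forall x, F x = F' x) -> (forall x, G x = G' x) ->
  covariance e F G = covariance e F' G'.
Proof.
move=> FF' GG'; rewrite /covariance (eq_mean FF') (eq_mean GG').
by apply: eq_mean => x; rewrite FF' GG'.
Qed.

Lemma covarianceE F G : covariance e F G = e (fun x => F x * G x) - e F * e G.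
Proof.
have -> : covariance e F G = e (fun x => (- e G) * F x + ((- e F) * G x +
    (F x * G x + e F * e G))) by apply: eq_mean => x; ring.
by rewrite !mean_linear meanD mean_cst; ring.
Qed.

Lemma prob_chebyshev F a : 0 < a ->
  prob e (fun x => a <= `|F x - e F|) <= variance e F / a ^+ 2.
Proof.
move=> a0; apply: le_trans (prob_markov _ _); rewrite ?exprn_gt0 //; last first.
  by move=> x; apply: sqr_ge0.
apply: le_prob => x aF; rewrite -[leRHS]real_normK ?num_real //.
by rewrite lerXn2r ?nnegrE // ltW.
Qed.

Lemma varianceB_le F G :
  variance e (fun x => F x - G x) <= 2 * (variance e F + variance e G).
Proof.
rewrite mulrDr -!meanZ -meanD; apply: le_mean => x; rewrite meanB.
by have := sqr_ge0 (F x - e F + (G x - e G)); rewrite !expr2; lra.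
Qed.

Section NonpositiveCovariance.
Variables (I : finType) (X : I -> T -> K).
Hypothesis covX : forall i j, i != j -> covariance e (X i) (X j) <= 0.

Lemma variance_sum_le_of_ge0 (a : I -> K) : (forall i, 0 <= a i) ->
  variance e (fun x => \sum_i a i * X i x) <= \sum_i a i ^+ 2 * variance e (X i).
Proof.
move=> a0.
have -> : variance e (fun x => \sum_i a i * X i x) =
    \sum_i \sum_j a i * a j * covariance e (X i) (X j).
  have centered x : \sum_i a i * X i x - e (fun x => \sum_i a i * X i x) =
      \sum_i a i * (X i x - e (X i)).
    by rewrite mean_sum -sumrB; apply: eq_bigr => i _; rewrite meanZ mulrBr.
  under eq_bigr do under eq_bigr do rewrite -meanZ.
  under eq_bigr do rewrite -mean_sum.
  rewrite -mean_sum; apply: eq_mean => x; rewrite centered expr2 big_distrlr /=.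
  by apply: eq_bigr => i _; apply: eq_bigr => j _; ring.
apply: ler_sum => i _; rewrite (bigD1 i) //= -[leRHS]addr0 -expr2 lerD2l.
by apply: sumr_le0 => j ji; rewrite mulr_ge0_le0 ?mulr_ge0 // covX // eq_sym.
Qed.

Lemma variance_sum_le (a : I -> K) :
  variance e (fun x => \sum_i a i * X i x) <= 2 * \sum_i a i ^+ 2 * variance e (X i).
Proof.
pose pos i := Num.max (a i) 0; pose neg i := Num.max (- a i) 0.
have aE i : a i = pos i - neg i.
  by rewrite /pos /neg; case: (leP (a i) 0); case: (leP (- a i) 0); lra.
have sqr_aE i : a i ^+ 2 = pos i ^+ 2 + neg i ^+ 2.
  by rewrite /pos /neg; case: (leP (a i) 0); case: (leP (- a i) 0); rewrite !expr2; nra.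
have -> : variance e (fun x => \sum_i a i * X i x) =
    variance e (fun x => \sum_i pos i * X i x - \sum_i neg i * X i x).
  have sumE x : \sum_i a i * X i x = \sum_i pos i * X i x - \sum_i neg i * X i x.
    by rewrite -sumrB; apply: eq_bigr => i _; rewrite aE mulrBl.
  exact: eq_variance.
apply: le_trans (varianceB_le _ _) _; apply: ler_wpM2l => //.
under [leRHS]eq_bigr do rewrite sqr_aE mulrDl.
by rewrite big_split; apply: lerD; apply: variance_sum_le_of_ge0 => i;
  rewrite le_max lexx orbT.
Qed.

End NonpositiveCovariance.
End Mean.

Section MeanMonad.
Variable K : realFieldType.

Lemma is_mean_dirac (T : Type) (x : T) : is_mean (fun F : T -> K => F x).
Proof. by split. Qed.

Definition dirac_mean (T : Type) (x : T) : mean K T := Mean (is_mean_dirac x).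

Lemma is_mean_bind (T U : Type) (e : mean K T) (f : T -> mean K U) :
  is_mean (fun F => e (fun x => f x F)).
Proof.
split=> [a F G | F G FG |].
- by rewrite -mean_linear; apply: eq_mean => x; rewrite mean_linear.
- by apply: le_mean => x; apply: le_mean.
- by rewrite -[RHS](mean_cst e); apply: eq_mean => x; rewrite mean_cst.
Qed.

Definition bind_mean (T U : Type) (e : mean K T) (f : T -> mean K U) : mean K U :=
  Mean (is_mean_bind e f).

Fixpoint prod_mean (T : Type) (N : nat) :
    ('I_N -> mean K T) -> mean K (N.-tuple T) :=
  if N is _.+1 then fun es =>
    bind_mean (es ord0) (fun x =>
      bind_mean (prod_mean (fun i => es (lift ord0 i))) (fun s =>
        dirac_mean [tuple of x :: s]))
  else fun=> dirac_mean [tuple].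

Definition iid (T : Type) (N : nat) (e : mean K T) : mean K (N.-tuple T) :=
  prod_mean (fun _ : 'I_N => e).

Lemma prod_mean_tnth (T : Type) (N : nat) (es : 'I_N -> mean K T) i (F : T -> K) :
  prod_mean es (fun s => F (tnth s i)) = es i F.
Proof.
elim: N es i => [|N IHN] es i /=; first by case: i.
case: (unliftP ord0 i) => [j|] ->; last first.
  by apply: eq_mean => x; rewrite -[RHS](mean_cst (prod_mean (es \o lift ord0))).
rewrite -[RHS](mean_cst (es ord0)); apply: eq_mean => x.
by rewrite -(IHN (es \o lift ord0)); apply: eq_mean => s; rewrite tnthS.
Qed.

Section Iid.
Variables (T : Type) (e : mean K T).
Implicit Types (F : T -> K) (A : pred T) (a : K).

Let iidS N (F : N.+1.-tuple T -> K) :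
  iid N.+1 e F = e (fun x => iid N e (fun s => F [tuple of x :: s])).
Proof. by []. Qed.

Lemma mean_iid_prod N (F : T -> K) :
  iid N e (fun s => \prod_(x <- s) F x) = e F ^+ N.
Proof.
elim: N => [|N IHN]; first by rewrite /= big_nil.
rewrite iidS exprSr -IHN -meanZ; apply: eq_mean => x.
by rewrite mulrC -meanZ; apply: eq_mean => s; rewrite /= big_cons.
Qed.

Lemma prob_iid_all N (A : pred T) : prob (iid N e) (all A) = prob e A ^+ N.
Proof.
rewrite -mean_iid_prod; apply: eq_mean => s; elim: (tval s) => [|x s' IHs] /=.
  by rewrite big_nil.
by rewrite big_cons -IHs -natrM mulnb.
Qed.

Lemma mean_iid_sum N (F : T -> K) :
  iid N e (fun s => \sum_(x <- s) F x) = N%:R * e F.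
Proof.
elim: N => [|N IHN]; first by rewrite /= big_nil mul0r.
rewrite iidS -natr1 mulrDl mul1r -IHN addrC -[X in _ + X](mean_cst e) -meanD.
apply: eq_mean => x; rewrite -[X in X + _](mean_cst (iid N e)) -meanD.
by apply: eq_mean => s; rewrite /= big_cons.
Qed.

Lemma variance_iid_sum N (F : T -> K) :
  variance (iid N e) (fun s => \sum_(x <- s) F x) = N%:R * variance e F.
Proof.
pose dev x := F x - e F.
have mean_dev : e dev = 0 by rewrite /dev meanB mean_cst subrr.
have -> : variance (iid N e) (fun s => \sum_(x <- s) F x) =
    iid N e (fun s => (\sum_(x <- s) dev x) ^+ 2).
  apply: eq_mean => s; rewrite mean_iid_sum sumrB big_const_seq count_predT.
  by rewrite size_tuple iter_addr_0 mulr_natl.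
elim: N => [|N IHN]; first by rewrite /= big_nil expr0n mul0r.
have split_sqr x : iid N e (fun s => (\sum_(y <- x :: s) dev y) ^+ 2) =
    dev x ^+ 2 + N%:R * variance e F.
  rewrite -IHN; pose S (s : N.-tuple T) := \sum_(y <- s) dev y.
  have expand (s : N.-tuple T) : (\sum_(y <- x :: s) dev y) ^+ 2 =
      2 * dev x * S s + (dev x ^+ 2 + S s ^+ 2) by rewrite big_cons /S; ring.
  rewrite (eq_mean _ expand) mean_linear meanD mean_cst mean_iid_sum mean_dev.
  by rewrite !mulr0 add0r.
by rewrite iidS (eq_mean _ split_sqr) meanD mean_cst -natr1 -/(variance e F); ring.
Qed.

Lemma prob_iid_chebyshev N (F : T -> K) a : 0 < a ->
  prob (iid N e) (fun s => a <= `|\sum_(x <- s) F x - N%:R * e F|) <=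
    N%:R * variance e F / a ^+ 2.
Proof. by rewrite -variance_iid_sum -mean_iid_sum; apply: prob_chebyshev. Qed.

(* Chernoff: when bad votes are not a minority, the product of the factors [a]
   (bad vote) and [a^-1] (good vote) is at least 1. *)
Lemma prob_iid_chernoff_half N (bad : pred T) a : 1 <= a ->
  prob (iid N e) (fun s => (size s <= 2 * count bad s)%N) <=
    (a * prob e bad + a^-1 * (1 - prob e bad)) ^+ N.
Proof.
move=> a1; have a0 : 0 < a by lra.
pose h x := if bad x then a else a^-1.
have h0 x : 0 <= h x by rewrite /h; case: ifP => _; rewrite ?invr_ge0 ltW.
have prod_h s : \prod_(x <- s) h x * a ^+ size s = a ^+ (2 * count bad s).
  elim: s => [|x s IHs]; first by rewrite big_nil mulr1.
  rewrite big_cons exprS mulrACA IHs mulnDr exprD /h; case: ifP => _ //=.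
  by rewrite mulVf ?gt_eqF.
have -> : a * prob e bad + a^-1 * (1 - prob e bad) = e h.
  rewrite -probC -[X in _ + X]meanZ -mean_linear; apply: eq_mean => x /=.
  by rewrite /h; case: (bad x); rewrite /= ?mulr1 ?mulr0 ?addr0 ?add0r.
rewrite -mean_iid_prod; apply: le_mean => s; case: leqP => votes /=.
  by rewrite -(ler_pM2r (exprn_gt0 (size s) a0)) prod_h mul1r ler_weXn2l.
exact: prodr_ge0.
Qed.

End Iid.
End MeanMonad.

(** * Hitting probabilities *)

Section Hit.
Variable K : realFieldType.
Implicit Types (x y p q : K) (t n : nat).

Lemma subrXX_ge x y n : 0 <= y -> y <= x ->
  n%:R * y ^+ n.-1 * (x - y) <= x ^+ n - y ^+ n.
Proof.
move=> y0 yx; rewrite subrXX [leRHS]mulrC.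
apply: ler_wpM2r; first by rewrite subr_ge0.
have -> : n%:R * y ^+ n.-1 = \sum_(i < n) y ^+ n.-1.
  by rewrite sumr_const card_ord mulr_natl.
apply: ler_sum => i _.
have -> : y ^+ n.-1 = y ^+ (n.-1 - i) * y ^+ i.
  by rewrite -exprD subnK // -ltnS (ltn_predK (ltn_ord i)).
by apply: ler_wpM2r; rewrite ?exprn_ge0 // lerXn2r // nnegrE // (le_trans y0).
Qed.

Lemma subrXX_le x y n : 0 <= y -> y <= x -> x <= 1 ->
  x ^+ n - y ^+ n <= n%:R * (x - y).
Proof.
move=> y0 yx x1; rewrite subrXX [leRHS]mulrC.
apply: ler_wpM2l; first by rewrite subr_ge0.
have -> : n%:R = \sum_(i < n) (1 : K) by rewrite sumr_const card_ord.
apply: ler_sum => i _.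
by apply: mulr_ile1; rewrite ?exprn_ge0 ?exprn_ile1 //; lra.
Qed.

Definition hit t p : K := 1 - (1 - p) ^+ t.

Lemma hit_ge0 t p : 0 <= p <= 1 -> 0 <= hit t p.
Proof. by move=> p01; rewrite subr_ge0 exprn_ile1 //; lra. Qed.

Lemma hit_le1 t p : p <= 1 -> hit t p <= 1.
Proof. by move=> p1; rewrite gerBl exprn_ge0 // subr_ge0. Qed.

Lemma le_hit t p q : q <= 1 -> p <= q -> hit t p <= hit t q.
Proof. by move=> q1 pq; rewrite lerD2l lerN2 lerXn2r ?nnegrE; lra. Qed.

Definition hit_gain t p q : K := (p - q) * (hit t p - hit t q).

Lemma hit_gainC t p q : hit_gain t p q = hit_gain t q p.
Proof. by rewrite /hit_gain -[in RHS]opprB -[X in _ = _ * X]opprB mulrNN. Qed.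

Lemma hit_gain_ge0 t p q : p <= 1 -> q <= 1 -> 0 <= hit_gain t p q.
Proof.
wlog pq : p q / q <= p => [le_case p1 q1|p1 q1].
  by have [|/ltW] := leP q p => pq; [|rewrite hit_gainC]; apply: le_case.
by rewrite mulr_ge0 ?subr_ge0 // le_hit.
Qed.

Lemma subr_hitE t p q : hit t p - hit t q = (1 - q) ^+ t - (1 - p) ^+ t.
Proof. by rewrite /hit; ring. Qed.

Lemma subr_hit_le t p q : 0 <= q -> q <= p -> p <= 1 ->
  hit t p - hit t q <= t%:R * (p - q).
Proof.
move=> q0 qp p1; rewrite subr_hitE.
have -> : p - q = 1 - q - (1 - p) by ring.
by apply: subrXX_le; lra.
Qed.

Lemma subr_hit_ge t p q : q <= p -> p <= 1 ->
  t%:R * (1 - p) ^+ t.-1 * (p - q) <= hit t p - hit t q.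
Proof.
move=> qp p1; rewrite subr_hitE.
have -> : p - q = 1 - q - (1 - p) by ring.
by apply: subrXX_ge; lra.
Qed.

Lemma hit_le t p : 0 <= p <= 1 -> hit t p <= t%:R * p.
Proof.
move=> /andP[p0 p1]; have := subr_hit_le t (lexx 0) p0 p1.
by rewrite !subr0 {2}/hit subr0 expr1n subrr subr0.
Qed.

Lemma subr1_hit_le t p : 0 <= p <= 1 -> 1 - hit t p <= (1 - p) ^+ t.-1.
Proof.
move=> p01; rewrite /hit opprB addrC subrK; case: t => [|t] //=.
by rewrite exprS ler_piMl ?exprn_ge0; lra.
Qed.

Lemma sqr_subr_hit_le t p q : 0 <= p <= 1 -> 0 <= q <= 1 ->
  (hit t p - hit t q) ^+ 2 <= t%:R * hit_gain t p q.
Proof.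
wlog pq : p q / q <= p => [le_case p01 q01|/andP[_ p1] /andP[q0 _]].
  have [|/ltW] := leP q p => pq; first exact: le_case.
  by rewrite hit_gainC -sqrrN opprB; apply: le_case.
rewrite expr2 /hit_gain mulrA; apply: ler_wpM2r; last exact: subr_hit_le.
by rewrite subr_ge0 le_hit.
Qed.

Lemma hit_gain_ge t p q : p <= q -> q <= 1 ->
  t%:R * (1 - q) ^+ t.-1 * (p - q) ^+ 2 <= hit_gain t p q.
Proof.
move=> pq q1; rewrite hit_gainC -sqrrN opprB expr2 mulrA [leRHS]mulrC.
by apply: ler_wpM2r; rewrite ?subr_ge0 // subr_hit_ge.
Qed.

Lemma hit_gain_ge_variance t p q : 0 <= p <= 1 -> 0 <= q <= 1 ->
  t%:R * (1 - q) ^+ t.-1 * ((p - q) ^+ 2 * (hit t p * (1 - hit t p))) <=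
    hit_gain t p q.
Proof.
move=> p01 q01; have /andP[_ q1] := q01; have /andP[_ p1] := p01.
have hit0 := hit_ge0 t p01; have hit1 := hit_le1 t p1.
have [pq|/ltW qp] := leP p q.
  apply: le_trans (hit_gain_ge t pq q1); apply: ler_wpM2l.
    by rewrite mulr_ge0 // exprn_ge0 // subr_ge0.
  by rewrite ler_piMr ?sqr_ge0 //; nra.
have d0 : 0 <= p - q by rewrite subr_ge0.
apply: le_trans (ler_wpM2l d0 (subr_hit_ge t qp p1)).
have -> : t%:R * (1 - q) ^+ t.-1 * ((p - q) ^+ 2 * (hit t p * (1 - hit t p))) =
  t%:R * (p - q) ^+ 2 * ((1 - q) ^+ t.-1 * hit t p * (1 - hit t p)) by ring.
have -> : (p - q) * (t%:R * (1 - p) ^+ t.-1 * (p - q)) =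
  t%:R * (p - q) ^+ 2 * (1 - p) ^+ t.-1 by ring.
apply: ler_wpM2l; first by rewrite mulr_ge0 ?sqr_ge0.
apply: le_trans (subr1_hit_le t p01); rewrite ler_piMl ?subr_ge0 //.
by apply: mulr_ile1 => //; rewrite ?exprn_ge0 ?exprn_ile1; lra.
Qed.

End Hit.

Section IidHit.
Variables (K : realFieldType) (T : Type) (e : mean K T) (t : nat).
Implicit Types A B : pred T.

Lemma prob_iid_has A : prob (iid t e) (has A) = hit t (prob e A).
Proof.
rewrite /hit -probC -prob_iid_all -[LHS](subKr 1) -probC; congr (1 - _).
by apply: eq_mean => s; rewrite /= all_predC.
Qed.

Lemma covariance_iid_has_le0 A B : (forall x, A x -> ~~ B x) ->
  covariance (iid t e) (fun s => (has A s)%:R) (fun s => (has B s)%:R) <= 0.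
Proof.
move=> disjoint_AB.
have pAB : prob e (predU A B) = prob e A + prob e B.
  rewrite -meanD; apply: eq_mean => x /=; rewrite -natrD.
  by case: (A x) (disjoint_AB x) => [/(_ isT)/negbTE ->|_].
have mean_has C : iid t e (fun s => (has C s)%:R) = hit t (prob e C).
  exact: prob_iid_has.
rewrite covarianceE !mean_has.
have -> : iid t e (fun s => (has A s)%:R * (has B s)%:R) =
    hit t (prob e A) + hit t (prob e B) - hit t (prob e A + prob e B).
  rewrite -pAB -!mean_has -meanD -meanB; apply: eq_mean => s.
  by rewrite has_predU; case: (has A s); case: (has B s) => /=; ring.
have pA0 : 0 <= prob e A by apply: mean_ge0.
have pB0 : 0 <= prob e B by apply: mean_ge0.
have pAB1 : prob e A + prob e B <= 1.
  by rewrite -pAB -[leRHS](mean_cst e); apply: le_mean => x; rewrite lern1 leq_b1.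
have : (1 - (prob e A + prob e B)) ^+ t <= ((1 - prob e A) * (1 - prob e B)) ^+ t.
  by apply: lerXn2r; rewrite ?nnegrE; nra.
rewrite exprMn /hit; set a := _ ^+ t; set b := _ ^+ t; set c := _ ^+ t; lra.
Qed.

End IidHit.

(** * Learning a distinguishing function from samples of [P] *)

Definition wmean (n : nat) (D F : 'I_n -> R) : R := \sum_x D x * F x.

Lemma is_mean_wmean (n : nat) (D : 'I_n -> R) : is_distr D -> is_mean (wmean D).
Proof.
case=> D0 D1; split=> [a F G | F G FG |].
- by rewrite /wmean mulr_sumr -big_split; apply: eq_bigr => x _ /=; ring.
- by apply: ler_sum => x _; apply: ler_wpM2l.
- by rewrite /wmean -[RHS]D1; apply: eq_bigr => x _; rewrite mulr1.
Qed.

Definition distr_mean (n : nat) (D : 'I_n -> R) (dD : is_distr D) : mean R 'I_n :=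
  Mean (is_mean_wmean dD).

Lemma is_distr_unif (n : nat) : (0 < n)%N -> is_distr (unif n).
Proof.
move=> n0; split=> [x|]; first by rewrite invr_ge0.
by rewrite sumr_const card_ord -[LHS]mulr_natl mulfV // pnatr_eq0 -lt0n.
Qed.

Lemma wmean_unif (n : nat) (F : 'I_n -> R) : wmean (unif n) F = n%:R^-1 * \sum_x F x.
Proof. by rewrite mulr_sumr. Qed.

Definition gap (n : nat) (P f : 'I_n -> R) : R := wmean P f - wmean (unif n) f.

Definition spread (n : nat) (P f : 'I_n -> R) : R :=
  variance (wmean P) f + variance (wmean (unif n)) f.

Definition hits (n t : nat) (gs : seq (t.-tuple 'I_n)) (x : 'I_n) : R :=
  \sum_(g <- gs) (x \in g)%:R.

Section DistrIid.
Variables (n t : nat) (P : 'I_n -> R).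
Hypothesis dP : is_distr P.

Lemma distr_ge0_le1 x : 0 <= P x <= 1.
Proof. by case: dP => P0 <-; rewrite P0 (bigD1 x) //= lerDl sumr_ge0. Qed.

Lemma mean_iid_distr_mem x :
  iid t (distr_mean dP) (fun s => (x \in s)%:R) = hit t (P x).
Proof.
have <- : prob (distr_mean dP) (pred1 x) = P x.
  rewrite /prob /= /wmean (bigD1 x) //= eqxx mulr1 big1 ?addr0 // => y /negbTE ->.
  by rewrite mulr0.
by rewrite -prob_iid_has; apply: eq_mean => s; rewrite has_pred1.
Qed.

Lemma variance_iid_distr_mem x :
  variance (iid t (distr_mean dP)) (fun s => (x \in s)%:R) =
    hit t (P x) * (1 - hit t (P x)).
Proof. by rewrite -mean_iid_distr_mem -variance_indicator. Qed.

Lemma variance_iid_distr_sum_mem_le (d : 'I_n -> R) :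
  variance (iid t (distr_mean dP)) (fun s => \sum_x d x * (x \in s)%:R) <=
    2 * \sum_x d x ^+ 2 * (hit t (P x) * (1 - hit t (P x))).
Proof.
under [X in _ <= _ * X]eq_bigr do rewrite -variance_iid_distr_mem.
apply: variance_sum_le => x y xy.
have mem_has z (s : t.-tuple 'I_n) : (z \in s)%:R = (has (pred1 z) s)%:R :> R.
  by rewrite has_pred1.
rewrite (eq_covariance _ (mem_has x) (mem_has y)); apply: covariance_iid_has_le0.
by move=> z /= /eqP ->.
Qed.

End DistrIid.

Section Learn.
Variables (n t r : nat) (P : 'I_n -> R) (eps : R).
Local Notation q := (n%:R^-1 : R).

Hypotheses (dP : is_distr P) (n0 : (0 < n)%N).

Local Notation EP := (distr_mean dP).
Local Notation EU := (distr_mean (is_distr_unif n0)).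
Local Notation Egroup := (iid t EP).
Local Notation Egroups := (iid r (iid t EP)).

Let nR : 0 < n%:R :> R. Proof. by rewrite ltr0n. Qed.

Let q01 : 0 <= q <= 1.
Proof. by rewrite invr_ge0 ler0n invf_le1 // ler1n. Qed.

Let P01 x := distr_ge0_le1 dP x.

Let gapE f : gap P f = EP f - EU f. Proof. by []. Qed.

Lemma gap_sum f : gap P f = \sum_x (P x - q) * f x.
Proof. by rewrite /gap /wmean -sumrB; apply: eq_bigr => x _; rewrite mulrBl. Qed.

Lemma gap_subr_cst f c : gap P (fun x => f x - c) = gap P f.
Proof. by rewrite !gapE !meanB !mean_cst; ring. Qed.

Definition group_gap (g : t.-tuple 'I_n) : R := gap P (fun x => (x \in g)%:R).

Lemma gap_hits (gs : seq (t.-tuple 'I_n)) :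
  gap P (hits gs) = \sum_(g <- gs) group_gap g.
Proof. by rewrite gapE !mean_sum -sumrB. Qed.

Lemma spread_ge0 f : 0 <= spread P f.
Proof. by rewrite addr_ge0 // (variance_ge0 EP, variance_ge0 EU). Qed.

Definition group_gain : R := \sum_x hit_gain t (P x) q.

Let gain_ge0 x : 0 <= hit_gain t (P x) q.
Proof. by apply: hit_gain_ge0; [case/andP: (P01 x) | case/andP: q01]. Qed.

Lemma group_gain_ge0 : 0 <= group_gain.
Proof. by apply: sumr_ge0. Qed.

Lemma group_gainE : group_gain = gap P (fun x => hit t (P x)).
Proof. by rewrite -(gap_subr_cst _ (hit t q)) gap_sum. Qed.

Lemma mean_group_gap : Egroup group_gap = group_gain.
Proof.
under eq_mean do rewrite /group_gap gap_sum; rewrite mean_sum group_gainE gap_sum.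
by apply: eq_bigr => x _; rewrite meanZ mean_iid_distr_mem.
Qed.

Definition signal : R := r%:R * group_gain.

Definition spread_bound : R := 2 * (r%:R * t%:R * q) + 4 * (r%:R * signal).

Definition separates (f : 'I_n -> R) : bool :=
  (signal / 2 <= gap P f) && (spread P f <= 32 * spread_bound).

Definition deficit (x : 'I_n) : R := Num.max (q - P x) 0.

Lemma sum_deficit : \sum_x deficit x = dTV P (unif n).
Proof.
have sum_dev : \sum_x (q - P x) = 0.
  by rewrite sumrB (proj2 (is_distr_unif n0)) (proj2 dP) subrr.
have -> : dTV P (unif n) = 2^-1 * \sum_x (`|P x - q| + (q - P x)).
  by rewrite big_split /= sum_dev addr0.
rewrite mulr_sumr; apply: eq_bigr => x _; rewrite /deficit.
by case: (lerP (q - P x) 0) => dev; [rewrite ger0_norm | rewrite ltr0_norm]; lra.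
Qed.

Lemma sum_sqr_deficit_ge : dTV P (unif n) ^+ 2 * q <= \sum_x deficit x ^+ 2.
Proof.
have q0 : 0 < q by rewrite invr_gt0.
rewrite -(ler_pM2l q0) -wmean_unif.
have -> : q * (dTV P (unif n) ^+ 2 * q) = EU deficit ^+ 2.
  by rewrite /= wmean_unif sum_deficit; ring.
exact: sqr_mean_le.
Qed.

Hypotheses (t0 : (0 < t)%N) (tn : (t <= uphalf n)%N) (r0 : (0 < r)%N).

Let tR : 0 < t%:R :> R. Proof. by rewrite ltr0n. Qed.

Lemma exprn_pred_group_ge : 2^-1 <= (1 - q) ^+ t.-1.
Proof.
have : t.-1%:R * q <= 2^-1.
  rewrite ler_pdivrMr // -ler_pdivrMl ?invr_gt0 // invrK -natrM ler_nat.
  by move: t0 tn; clear; lia.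
by have := hit_le t.-1 q01; rewrite /hit; lra.
Qed.

Lemma group_gain_ge : t%:R * dTV P (unif n) ^+ 2 * q <= 2 * group_gain.
Proof.
have slope := exprn_pred_group_ge.
rewrite -mulrA; apply: le_trans (ler_wpM2l (ler0n _ _) sum_sqr_deficit_ge) _.
rewrite !mulr_sumr; apply: ler_sum => x _.
have gain0 := gain_ge0 x; rewrite /deficit.
have [_|] := lerP (q - P x) 0; first by rewrite expr0n mulr0; lra.
rewrite subr_gt0 => dev.
have [_ q1] := andP q01; have gain_ge := hit_gain_ge t (ltW dev) q1.
have := ler_wpM2l (mulr_ge0 (ltW tR) (sqr_ge0 (P x - q))) slope.
rewrite -[q - P x]opprB sqrrN; lra.
Qed.

Lemma variance_group_gap_le :
  t%:R * variance Egroup group_gap <= 4 * group_gain.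
Proof.
rewrite (eq_variance _ (fun g => gap_sum _)).
apply: le_trans (ler_wpM2l (ltW tR) (variance_iid_distr_sum_mem_le _ dP _)) _.
set S := \sum_x _.
have S0 : 0 <= S.
  apply: sumr_ge0 => x _; rewrite mulr_ge0 ?sqr_ge0 //.
  by rewrite -variance_iid_distr_mem variance_ge0.
have : t%:R * (1 - q) ^+ t.-1 * S <= group_gain.
  by rewrite mulr_sumr; apply: ler_sum => x _; apply: hit_gain_ge_variance.
have := ler_wpM2l (mulr_ge0 (ltW tR) S0) exprn_pred_group_ge.
lra.
Qed.

Lemma prob_gap_hits_small : 0 < signal ->
  prob Egroups (fun gs => gap P (hits gs) < signal / 2) <= 16 / (t%:R * signal).
Proof.
move=> signal0; have half0 : 0 < signal / 2 by rewrite divr_gt0.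
apply: le_trans (_ : r%:R * variance Egroup group_gap / (signal / 2) ^+ 2 <= _).
  apply: le_trans (prob_iid_chebyshev _ _ _ half0); apply: le_prob => gs.
  rewrite gap_hits mean_group_gap -/signal => small.
  by rewrite ler0_norm; lra.
rewrite ler_pdivrMr ?exprn_gt0 //.
have -> : 16 / (t%:R * signal) * (signal / 2) ^+ 2 = r%:R * (4 * group_gain) / t%:R.
  have -> : r%:R * (4 * group_gain) = 4 * signal by rewrite /signal; ring.
  by field; rewrite !gt_eqF.
rewrite ler_pdivlMr // -mulrA [_ * t%:R]mulrC; apply: ler_wpM2l => //.
exact: variance_group_gap_le.
Qed.

Lemma mean_sqr_hits x :
  Egroups (fun gs => (hits gs x - r%:R * hit t q) ^+ 2) =
    r%:R * (hit t (P x) * (1 - hit t (P x))) +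
    r%:R ^+ 2 * (hit t (P x) - hit t q) ^+ 2.
Proof.
rewrite mean_sqr_subr variance_iid_sum variance_iid_distr_mem.
by rewrite mean_iid_sum mean_iid_distr_mem; ring.
Qed.

Lemma spread_le f c : spread P f <= \sum_x (P x + q) * (f x - c) ^+ 2.
Proof.
under eq_bigr do rewrite mulrDl.
by rewrite big_split; apply: lerD;
  [apply: (variance_le_mean_sqr_subr EP) | apply: (variance_le_mean_sqr_subr EU)].
Qed.

Lemma sum_hit_variance_le :
  \sum_x (P x + q) * (hit t (P x) * (1 - hit t (P x))) <=
    group_gain + 2 * (t%:R * q).
Proof.
have -> : group_gain + 2 * (t%:R * q) =
    \sum_x ((P x - q) * hit t (P x) + 2 * t%:R * q * P x).
  by rewrite big_split /= -gap_sum -group_gainE -mulr_sumr (proj2 dP); ring.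
apply: ler_sum => x _; have /andP[P0 P1] := P01 x; have /andP[q0 q1] := q01.
have hit0 := hit_ge0 t (P01 x); have hit1 := hit_le1 t P1.
have : (P x + q) * (hit t (P x) * (1 - hit t (P x))) <= (P x + q) * hit t (P x).
  by apply: ler_wpM2l; [lra | rewrite ler_piMr // gerBl].
have := ler_wpM2l q0 (hit_le t (P01 x)); lra.
Qed.

Lemma sum_sqr_subr_hit_le :
  \sum_x (P x + q) * (hit t (P x) - hit t q) ^+ 2 <= 3 * group_gain.
Proof.
rewrite mulr_sumr; apply: ler_sum => x _; set d := hit t (P x) - hit t q.
have /andP[P0 P1] := P01 x; have /andP[q0 q1] := q01.
have gain0 := gain_ge0 x.
have d1 : d <= 1.
  by have := hit_ge0 t q01; have := hit_le1 t P1; rewrite /d; lra.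
have tq1 : t%:R * q <= 1.
  by rewrite ler_pdivrMr // mul1r ler_nat; move: tn; clear; lia.
have -> : (P x + q) * d ^+ 2 = hit_gain t (P x) q * d + 2 * (q * d ^+ 2).
  by rewrite /hit_gain -/d; ring.
have := ler_piMr gain0 d1; have := ler_wpM2l q0 (sqr_subr_hit_le t (P01 x) q01).
have := ler_piMl gain0 tq1; rewrite -/d; lra.
Qed.

Lemma mean_spread_hits_le : Egroups (fun gs => spread P (hits gs)) <= spread_bound.
Proof.
have spread_hits_le (gs : r.-tuple (t.-tuple 'I_n)) :=
  spread_le (hits gs) (r%:R * hit t q).
apply: le_trans (le_mean _ spread_hits_le) _.
rewrite mean_sum; under eq_bigr do
  rewrite meanZ mean_sqr_hits mulrDr [X in X + _]mulrCA [X in _ + X]mulrCA.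
rewrite big_split -!mulr_sumr /=.
have gain_le : r%:R * group_gain <= r%:R ^+ 2 * group_gain.
  by rewrite expr2 -mulrA ler_peMl ?mulr_ge0 ?ler1n // group_gain_ge0.
have := ler_wpM2l (ler0n _ r) sum_hit_variance_le.
have := ler_wpM2l (sqr_ge0 (r%:R : R)) sum_sqr_subr_hit_le.
rewrite /spread_bound /signal; lra.
Qed.

Hypotheses (eps0 : 0 < eps) (farP : eps <= dTV P (unif n)).

Lemma signal_ge : r%:R * t%:R * q * eps ^+ 2 <= 2 * signal.
Proof.
have gain_ge : t%:R * eps ^+ 2 * q <= 2 * group_gain.
  apply: le_trans group_gain_ge; apply: ler_wpM2r; first by case/andP: q01.
  have dTV0 := le_trans (ltW eps0) farP.
  by apply: ler_wpM2l => //; rewrite lerXn2r ?nnegrE ?(ltW eps0).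
have := ler_wpM2l (ler0n _ r) gain_ge; rewrite /signal; lra.
Qed.

Lemma signal_gt0 : 0 < signal.
Proof.
have : 0 < r%:R * t%:R * q * eps ^+ 2.
  by rewrite !mulr_gt0 ?exprn_gt0 ?invr_gt0 ?ltr0n.
have := signal_ge; lra.
Qed.

Lemma prob_hits_not_separates : 1024 <= t%:R * signal ->
  prob Egroups (fun gs => ~~ separates (hits gs)) <= 18^-1.
Proof.
move=> big_signal; have signal0 := signal_gt0.
have bound0 : 0 < spread_bound.
  have : 0 < r%:R * signal by rewrite mulr_gt0 ?ltr0n.
  have : 0 <= r%:R * t%:R * q by rewrite !mulr_ge0 // ltW // invr_gt0.
  rewrite /spread_bound; lra.
have small_gap := prob_gap_hits_small signal0.
have large_spread :
    prob Egroups (fun gs => 32 * spread_bound <= spread P (hits gs)) <= 32^-1.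
  have bound32 : 0 < 32 * spread_bound by rewrite mulr_gt0.
  apply: le_trans (prob_markov _ bound32 (fun gs => spread_ge0 _)) _.
  rewrite ler_pdivrMr //; have := mean_spread_hits_le; lra.
have : 16 / (t%:R * signal) <= 64^-1 by rewrite ler_pdivrMr; lra.
suff : prob Egroups (fun gs => ~~ separates (hits gs)) <=
    prob Egroups (fun gs => gap P (hits gs) < signal / 2) +
    prob Egroups (fun gs => 32 * spread_bound <= spread P (hits gs)) by lra.
apply: le_trans (probU_le _ _ _); apply: le_prob => gs /=.
by rewrite negb_and -!ltNge => /orP[->//|/ltW ->]; rewrite orbT.
Qed.

End Learn.

(** * Testing a block of samples, and the majority vote *)

Section Test.
Variables (n : nat) (f : 'I_n -> R).
Hypotheses (n0 : (0 < n)%N) (dU : is_distr (unif n)).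

Definition excess (ys : seq 'I_n) : R :=
  \sum_(y <- ys) f y - (size ys)%:R * wmean (unif n) f.

Definition accept (ys : seq 'I_n) : bool :=
  4 * Num.sqrt ((size ys)%:R * variance (wmean (unif n)) f) < excess ys.

Variable m : nat.

Local Notation EU := (distr_mean dU).

Lemma excess_eq0 (ys : seq 'I_n) :
  (size ys)%:R * variance (wmean (unif n)) f = 0 -> excess ys = 0.
Proof.
have n_neq0 : n%:R^-1 != 0 :> R by rewrite invr_eq0 pnatr_eq0 -lt0n.
move/eqP; rewrite mulf_eq0 pnatr_eq0 => /orP[/nilP -> | /eqP var0].
  by rewrite /excess big_nil mul0r subrr.
have f_cst x : f x = wmean (unif n) f.
  move: var0; rewrite /variance wmean_unif => /eqP; rewrite mulf_eq0 (negbTE n_neq0) /=.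
  move=> /eqP sum0; apply/eqP; rewrite -subr_eq0 -sqrf_eq0; apply/eqP.
  by apply: (psumr_eq0P _ sum0) => // y _; apply: sqr_ge0.
rewrite /excess; under eq_bigr do rewrite f_cst.
by rewrite big_const_seq count_predT iter_addr_0 mulr_natl subrr.
Qed.

Lemma prob_accept_unif : prob (iid m EU) (accept \o val) <= 16^-1.
Proof.
set v := m%:R * variance EU f.
have v0 : 0 <= v by rewrite mulr_ge0 // variance_ge0.
have [/eqP v_eq0|v_neq0] := boolP (v == 0).
  rewrite -[leRHS](mean_cst (iid m EU)); apply: le_mean => ys /=.
  have size_v : (size ys)%:R * variance (wmean (unif n)) f = 0 by rewrite size_tuple.
  by rewrite /accept size_v sqrtr0 excess_eq0 // mulr0 ltxx invr_ge0.
have sd0 : 0 < 4 * Num.sqrt v by rewrite mulr_gt0 // sqrtr_gt0 lt_neqAle eq_sym v_neq0.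
apply: le_trans (_ : v / (4 * Num.sqrt v) ^+ 2 <= _).
  apply: le_trans (prob_iid_chebyshev EU m f sd0); apply: le_prob => ys /=.
  rewrite /accept /excess size_tuple => /ltW over.
  exact: le_trans over (real_ler_norm (num_real _)).
rewrite exprMn sqr_sqrtr // -[v in v / _]mul1r -mulf_div divff // mulr1 expr2; lra.
Qed.

Lemma prob_reject_far (P : 'I_n -> R) (dP : is_distr P) (v mu : R) :
  (0 < m)%N -> 0 < mu -> mu <= gap P f -> spread P f <= v ->
  64 * v <= m%:R * mu ^+ 2 ->
  prob (iid m (distr_mean dP)) (predC (accept \o val)) <= 16^-1.
Proof.
move=> m0 mu0 mu_gap spread_v v_mu; set EP := distr_mean dP.
have mR : 0 < m%:R :> R by rewrite ltr0n.
have varP0 : 0 <= variance EP f by apply: variance_ge0.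
have varU0 : 0 <= variance EU f by apply: variance_ge0.
have var_le : variance EP f + variance EU f <= v by [].
have half0 : 0 < m%:R * mu / 2 by rewrite divr_gt0 // mulr_gt0.
have threshold_le : 4 * Num.sqrt (m%:R * variance EU f) <= m%:R * mu / 2.
  rewrite -ler_sqr ?nnegrE ?(ltW half0) ?mulr_ge0 ?sqrtr_ge0 //.
  rewrite exprMn sqr_sqrtr ?mulr_ge0 ?(ltW mR) //.
  have := ler_wpM2l (ltW mR) v_mu; have := ler_wpM2l (ltW mR) var_le.
  by have := mulr_ge0 (ltW mR) varP0; rewrite !expr2; lra.
apply: le_trans (_ : m%:R * variance EP f / (m%:R * mu / 2) ^+ 2 <= _).
  apply: le_trans (prob_iid_chebyshev EP m f half0); apply: le_prob => ys /=.
  rewrite /accept /excess size_tuple -leNgt => reject.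
  have := ler_wpM2l (ltW mR) mu_gap; rewrite /gap => mean_diff.
  have /= sum_le := le_trans reject threshold_le.
  by rewrite ler0_norm /=; lra.
rewrite ler_pdivrMr ?exprn_gt0 //.
have := ler_wpM2l (ltW mR) v_mu; have := ler_wpM2l (ltW mR) var_le.
by have := mulr_ge0 (ltW mR) varU0; rewrite !expr2; lra.
Qed.

End Test.

Definition majority (T : Type) (a : pred T) (s : seq T) : bool :=
  (size s < 2 * count a s)%N.

Lemma prob_iid_majority_wrong (K : realFieldType) (T : Type) (e : mean K T) (N : nat)
    (a : pred T) (b : bool) :
  prob e (fun x => a x != b) <= 16^-1 ->
  prob (iid N e) (fun s => majority a s != b) <= 2^-1 ^+ N.
Proof.
set bad := fun x => a x != b => few_bad; have p0 : 0 <= prob e bad by apply: mean_ge0.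
have four_ge1 : 1 <= 4 :> K by rewrite ler1n.
apply: le_trans (_ : prob (iid N e) (fun s => (size s <= 2 * count bad s)%N) <= _).
  apply: le_prob => s; rewrite /majority; case: b @bad {few_bad p0} => bad.
    have -> : count bad s = count (predC a) s.
      by apply: eq_count => x; rewrite /bad eqb_id.
    by rewrite -(count_predC a s); lia.
  have -> : count bad s = count a s.
    by apply: eq_count => x; rewrite /bad eqbF_neg negbK.
  by rewrite eqbF_neg negbK => /ltnW.
apply: le_trans (prob_iid_chernoff_half e N bad four_ge1) _.
by apply: lerXn2r; rewrite ?nnegrE; lra.
Qed.

(** * The algorithm *)

Definition sampler (n k : nat) (T : Type) : Type := (T -> alg n k) -> alg n k.

Section Sampler.
Variables (n k : nat).

Fixpoint sample_tuple (T : Type) (N : nat) :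
    ('I_N -> sampler n k T) -> sampler n k (N.-tuple T) :=
  if N is _.+1 then fun S c =>
    S ord0 (fun x => sample_tuple (fun i => S (lift ord0 i)) (fun s =>
      c [tuple of x :: s]))
  else fun _ c => c [tuple].

Definition sample_block (m : nat) (j : 'I_k.+1) : sampler n k (m.-tuple 'I_n) :=
  sample_tuple (fun _ : 'I_m => Sample j).
Arguments sample_block : clear implicits.

Definition costs (T : Type) (S : sampler n k T) (w : nat) : Prop :=
  forall c B, (forall x, nsamples (c x) <= B)%N -> (nsamples (S c) <= w + B)%N.

Definition simulates (src : 'I_k.+1 -> 'I_n -> R) (T : Type) (S : sampler n k T)
    (e : mean R T) : Prop :=
  forall c good, succ_prob (S c) src good = e (fun x => succ_prob (c x) src good).

Lemma costs_sample_tuple (T : Type) (N w : nat) (S : 'I_N -> sampler n k T) :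
  (forall i, costs (S i) w) -> costs (sample_tuple S) (N * w).
Proof.
elim: N S => [|N IHN] S costS c B leB /=; first exact: leB.
by rewrite mulSn -addnA; apply: (costS ord0) => x; apply: IHN => [i|s]; [exact: costS|].
Qed.

Lemma costs_sample_block m j : costs (sample_block m j) m.
Proof.
rewrite -[m in X in costs _ X]muln1; apply: costs_sample_tuple => _ c B leB.
by rewrite /= add1n ltnS; apply/bigmax_leqP => x _.
Qed.

Lemma simulates_sample_tuple src (T : Type) (N : nat) (S : 'I_N -> sampler n k T)
    (es : 'I_N -> mean R T) :
  (forall i, simulates src (S i) (es i)) ->
  simulates src (sample_tuple S) (prod_mean es).
Proof.
elim: N S es => [//|N IHN] S es simS c good /=; rewrite simS.
by apply: eq_mean => x; apply: (IHN _ (fun i => es (lift ord0 i))).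
Qed.

Lemma simulates_sample_block src m j (D : 'I_n -> R) (dD : is_distr D) :
  src j = D -> simulates src (sample_block m j) (iid m (distr_mean dD)).
Proof. by move: dD => /[swap] <- dD; apply: simulates_sample_tuple. Qed.

End Sampler.
Arguments sample_block {n k} m j _.

Definition classifier (n k r t m v : nat) : alg n k :=
  sample_tuple (fun _ : 'I_r => sample_block t ord0) (fun gs =>
    sample_tuple (fun i : 'I_k =>
      sample_tuple (fun _ : 'I_v => sample_block m (lift ord0 i))) (fun ballots =>
        Output (fun i => majority (accept (hits gs) \o val) (tnth ballots i)))).

Lemma nsamples_classifier (n k r t m v : nat) :
  (nsamples (classifier n k r t m v) <= r * t + k * (v * m))%N.
Proof.
apply: costs_sample_tuple => [_|gs]; first exact: costs_sample_block.
rewrite -[leqRHS]addn0; apply: costs_sample_tuple => // i.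
by apply: costs_sample_tuple => _; apply: costs_sample_block.
Qed.

Lemma sources_ord0 (n k : nat) (P : 'I_n -> R) (b : 'I_k -> bool) :
  sources P b ord0 = P.
Proof. by rewrite /sources unlift_none. Qed.

Lemma sources_lift (n k : nat) (P : 'I_n -> R) (b : 'I_k -> bool) (i : 'I_k) :
  sources P b (lift ord0 i) = if b i then P else unif n.
Proof. by rewrite /sources liftK. Qed.

Section Classify.
Variables (n k r t m v : nat) (P : 'I_n -> R) (eps : R) (b : 'I_k -> bool).
Hypotheses (dP : is_distr P) (n0 : (0 < n)%N) (t0 : (0 < t)%N) (r0 : (0 < r)%N).
Hypotheses (m0 : (0 < m)%N) (tn : (t <= uphalf n)%N).
Hypotheses (eps0 : 0 < eps) (farP : eps <= dTV P (unif n)).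
Hypothesis signal_big : 1024 <= t%:R * signal t r P.
Hypothesis block_big : 8192 * spread_bound t r P <= m%:R * signal t r P ^+ 2.
Hypothesis votes : (18 * k <= expn 2 v)%N.

Let is_distr_source i : is_distr (if b i then P else unif n).
Proof. by case: (b i) => //; apply: is_distr_unif. Qed.

Let Eblock i : mean R (m.-tuple 'I_n) := iid m (distr_mean (is_distr_source i)).
Let Eballots := prod_mean (fun i : 'I_k => iid v (Eblock i)).

Lemma prob_accept_wrong f i : separates t r P f ->
  prob (Eblock i) (fun ys => (accept f \o val) ys != b i) <= 16^-1.
Proof.
move=> /andP[gap_f spread_f]; rewrite /Eblock; move: (is_distr_source i).
case: (b i) => [dP'|dU].
  have half0 : 0 < signal t r P / 2.
    by rewrite divr_gt0 // (signal_gt0 dP n0 t0 tn r0 eps0 farP).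
  have spread_small : 64 * (32 * spread_bound t r P) <= m%:R * (signal t r P / 2) ^+ 2.
    by move: block_big; rewrite !expr2; lra.
  have dU := is_distr_unif n0.
  apply: le_trans (prob_reject_far dU dP' m0 half0 gap_f spread_f spread_small).
  by apply: le_prob => ys /=; case: (accept _ _).
apply: le_trans (prob_accept_unif f n0 dU m).
by apply: le_prob => ys /=; case: (accept _ _).
Qed.

Lemma prob_ballots_wrong f : separates t r P f ->
  prob Eballots (fun ballots =>
    [exists i, majority (accept f \o val) (tnth ballots i) != b i]) <= 18^-1.
Proof.
move=> sep_f; apply: le_trans (prob_exists_le _ _) _.
apply: le_trans (_ : \sum_(i < k) 2^-1 ^+ v <= _).
  apply: ler_sum => i _.
  pose wrong (s : v.-tuple (m.-tuple 'I_n)) := majority (accept f \o val) s != b i.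
  rewrite /prob (prod_mean_tnth _ i (fun s => (wrong s)%:R)).
  by apply: prob_iid_majority_wrong; apply: prob_accept_wrong.
rewrite sumr_const card_ord -[_ *+ k]mulr_natl exprVn ler_pdivrMr ?exprn_gt0 //.
have : (18 * k)%:R <= (expn 2 v)%:R :> R by rewrite ler_nat.
by rewrite natrM natrX; lra.
Qed.

Lemma succ_prob_classifier :
  succ_prob (classifier n k r t m v) (sources P b) (correct b) =
    iid r (iid t (distr_mean dP)) (fun gs => prob Eballots (fun ballots =>
      correct b (fun i => majority (accept (hits gs) \o val) (tnth ballots i)))).
Proof.
rewrite (@simulates_sample_tuple _ _ _ _ _ _ (fun=> iid t (distr_mean dP))); last first.
  by move=> _; apply: simulates_sample_block (sources_ord0 _ _).
apply: eq_mean => gs.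
rewrite (@simulates_sample_tuple _ _ _ _ _ _ (fun i => iid v (Eblock i))); last first.
  move=> i; apply: simulates_sample_tuple => _.
  exact: simulates_sample_block (sources_lift _ _ _).
by apply: eq_mean => ballots /=; case: (correct _ _).
Qed.

Lemma classifier_correct :
  8 / 9 <= succ_prob (classifier n k r t m v) (sources P b) (correct b).
Proof.
rewrite succ_prob_classifier.
have not_separates := prob_hits_not_separates dP n0 t0 tn r0 eps0 farP signal_big.
pose good (gs : r.-tuple (t.-tuple 'I_n)) := separates t r P (hits gs).
have : 8 / 9 <= 17 / 18 - prob (iid r (iid t (distr_mean dP))) (predC good) by lra.
move=> /le_trans; apply.
apply: mean_ge_subprobC => [|gs|]; [lra | exact: mean_ge0 |].
move=> gs /prob_ballots_wrong wrong.
have -> : 17 / 18 = 1 - 18^-1 :> R by lra.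
apply: le_trans (lerB (lexx 1) wrong) _; rewrite -probC; apply: le_prob => ballots /=.
by rewrite negb_exists => /forallP votes_ok; apply/forallP => i; rewrite -[_ == _]negbK.
Qed.

End Classify.

(** * Choice of the parameters *)

Lemma ln_le (x y : R) : 0 < x -> x <= y -> ln x <= ln y.
Proof.
move=> x0; rewrite le_eqVlt => /orP[/eqP -> //|/RltP xy].
by apply/ltW/RltP/ln_increasing => //; apply/RltP.
Qed.

Lemma half_lt_ln2 : 2^-1 < ln 2.
Proof. by have /RltP := ln_lt_2; rewrite RinvE IZRposE INRE. Qed.

Lemma ln_exprn (x : R) (N : nat) : 0 < x -> ln (x ^+ N) = N%:R * ln x.
Proof. by move=> /RltP x0; rewrite -RpowE ln_pow // INRE. Qed.

Section Votes.
Variable k : nat.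

Definition klogk : R := k%:R * ln k%:R.

Definition nvotes : nat := (trunc_log 2 k + 6)%N.

Lemma nvotes_ge : (18 * k <= expn 2 nvotes)%N.
Proof.
have := trunc_log_ltn k (isT : 1 < 2)%N; rewrite /nvotes expnD expnS.
by rewrite (_ : expn 2 6 = 64)%N //; lia.
Qed.

Hypothesis k2 : (2 <= k)%N.

Lemma half_le_ln : 2^-1 <= ln k%:R.
Proof. by apply: le_trans (ltW half_lt_ln2) (ln_le _ _); rewrite ?ler_nat. Qed.

Lemma klogk_ge1 : 1 <= klogk.
Proof.
have : 2 <= k%:R :> R by rewrite ler_nat.
rewrite /klogk; have := half_le_ln; nra.
Qed.

Lemma nvotes_le : nvotes%:R <= 14 * ln k%:R.
Proof.
have : (trunc_log 2 k)%:R * ln 2 <= ln k%:R.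
  rewrite -ln_exprn //; apply: ln_le; first exact: exprn_gt0.
  by rewrite -natrX ler_nat trunc_logP // ltnW.
have := ler_wpM2l (ler0n R (trunc_log 2 k)) (ltW half_lt_ln2).
have := half_le_ln; rewrite /nvotes natrD; lra.
Qed.

End Votes.

Lemma truncnS_le (K : archiRealFieldType) (c x : K) : 0 <= c -> 1 <= x ->
  (Num.trunc (c * x)).+1%:R <= (c + 1) * x.
Proof.
move=> c0 x1; have : (Num.trunc (c * x))%:R <= c * x.
  by rewrite truncn_le mulr_ge0 //; lra.
rewrite -natr1; lra.
Qed.

Lemma noise_le_sqr_signal (K : realFieldType) (c m z r s e : K) :
  0 <= c -> 0 <= m -> 0 <= z -> 0 <= r -> 0 <= s -> r * z * e ^+ 2 <= 2 * s ->
  c <= m * (r * z) * e ^+ 4 -> c <= m * z * e ^+ 2 ->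
  c * (2 * (r * z) + 4 * (r * s)) <= 16 * (m * s ^+ 2).
Proof.
move=> c0 m0 z0 r0 s0 s_ge c_le4 c_le2.
have y0 : 0 <= r * z by rewrite mulr_ge0.
have noise_le : c * (r * z) <= 4 * (m * s ^+ 2).
  have /(ler_wpM2l m0) : (r * z * e ^+ 2) ^+ 2 <= (2 * s) ^+ 2.
    by apply: lerXn2r => //; rewrite nnegrE mulr_ge0 // sqr_ge0.
  have := ler_wpM2l y0 c_le4; rewrite !expr2; lra.
have fluctuation_le : c * (r * s) <= 2 * (m * s ^+ 2).
  have := ler_wpM2l (mulr_ge0 m0 s0) s_ge; have := ler_wpM2l (mulr_ge0 r0 s0) c_le2.
  rewrite !expr2; lra.
lra.
Qed.

Section SampleSizes.
Variables (n k : nat) (eps : R).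
Local Notation L := (klogk k).

Definition budget : R := bound 1 n k eps.
(* Large enough for [signal_big] and [block_big]; not optimized. *)
Definition oversampling : R := 64 * 64 * 64.
Definition nlearn : nat := (Num.trunc (oversampling * budget)).+1.
Definition ngroup : nat := minn nlearn (uphalf n).
Definition ngroups : nat := (nlearn %/ ngroup).+1.
Definition nblock : nat := (Num.trunc (oversampling * (budget / L))).+1.

Hypotheses (k2 : (2 <= k)%N) (n0 : (0 < n)%N) (eps0 : 0 < eps) (eps1 : eps <= 1).

Lemma boundE C : bound C n k eps = C * budget.
Proof. by rewrite /budget /bound /=; case: ifP => _; rewrite mul1r -[LHS]mulrA. Qed.

Let L_ge1 : 1 <= L. Proof. exact: klogk_ge1. Qed.

Let L_gt0 : 0 < L. Proof. exact: lt_le_trans L_ge1. Qed.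

Let eps2_gt0 : 0 < eps ^+ 2. Proof. exact: exprn_gt0. Qed.

Let eps2_le1 : eps ^+ 2 <= 1. Proof. by rewrite exprn_ile1 // ltW. Qed.

Let oversampling0 : 0 <= oversampling. Proof. by rewrite !mulr_ge0. Qed.

Lemma budget_ge : L <= budget * eps ^+ 2.
Proof.
rewrite /budget /bound -/L.
case: ifP => [Ln|_]; rewrite mul1r divfK ?gt_eqF //.
rewrite RsqrtE -[leLHS]ger0_norm ?(ltW L_gt0) // -sqrtr_sqr ler_sqrt.
  by rewrite expr2 ler_pM2r.
by rewrite mulr_ge0 // ltW.
Qed.

Lemma budget_sqr_ge : n%:R * L <= (budget * eps ^+ 2) ^+ 2.
Proof.
rewrite /budget /bound -/L.
case: (leP L n%:R) => [_|/ltW nL]; rewrite mul1r divfK ?gt_eqF //.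
  by rewrite RsqrtE sqr_sqrtr // mulr_ge0 // ltW.
by rewrite expr2 ler_pM2r.
Qed.

Lemma budget_ge1 : 1 <= budget.
Proof. by move: budget_ge L_ge1 eps2_gt0 eps2_le1; nra. Qed.

Lemma block_ratio_ge : 1 <= budget / L * eps ^+ 2.
Proof. by rewrite mulrAC ler_pdivlMr // mul1r budget_ge. Qed.

Lemma block_ratio_ge1 : 1 <= budget / L.
Proof. by move: block_ratio_ge eps2_gt0 eps2_le1; nra. Qed.

Lemma budget_mul_block_ratio_ge : n%:R <= budget * (budget / L) * eps ^+ 4.
Proof.
have -> : budget * (budget / L) * eps ^+ 4 = (budget * eps ^+ 2) ^+ 2 / L by ring.
by rewrite ler_pdivlMr // budget_sqr_ge.
Qed.

Lemma ngroup_gt0 : (0 < ngroup)%N.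
Proof. by rewrite leq_min /=; case: n n0. Qed.

Lemma ngroups_mul_ge : (nlearn <= ngroups * ngroup)%N.
Proof. by rewrite ltnW // ltn_ceil // ngroup_gt0. Qed.

Lemma ngroups_mul_le : (ngroups * ngroup <= 2 * nlearn)%N.
Proof.
by rewrite /ngroups mulSn mul2n -addnn leq_add ?leq_trunc_div ?geq_minl.
Qed.

Lemma nsamples_le :
  (ngroups * ngroup + k * (nvotes k * nblock))%:R <=
    16 * (oversampling + 1) * budget.
Proof.
have learn_le : (ngroups * ngroup)%:R <= 2 * ((oversampling + 1) * budget).
  apply: le_trans (_ : (2 * nlearn)%:R <= _); first by rewrite ler_nat ngroups_mul_le.
  by rewrite natrM; apply: ler_wpM2l => //; apply: truncnS_le budget_ge1.
have vote_le : (k * (nvotes k * nblock))%:R <= 14 * ((oversampling + 1) * budget).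
  have -> : 14 * ((oversampling + 1) * budget) =
      k%:R * (14 * ln k%:R * ((oversampling + 1) * (budget / L))).
    have {1}-> : budget = L * (budget / L) by rewrite mulrC divfK ?gt_eqF.
    by rewrite /klogk; ring.
  rewrite !natrM; apply: ler_wpM2l => //; apply: ler_pM => //; first exact: nvotes_le.
  exact: truncnS_le block_ratio_ge1.
by rewrite natrD; lra.
Qed.

(* If [ngroup] is [nlearn], it exceeds [budget]; otherwise it is at least [n / 2]. *)
Lemma mul_ngroup_ge (a x : R) : 0 <= x -> a <= x * eps ^+ 2 ->
  a * n%:R <= x * budget * eps ^+ 4 -> a * n%:R <= 2 * (x * ngroup%:R * eps ^+ 2).
Proof.
move=> x0 ax anx; rewrite /ngroup; case: leqP => _; last first.
  have half_n : n%:R <= 2 * (uphalf n)%:R :> R.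
    by rewrite -natrM ler_nat mul2n -leq_uphalf_double.
  have xe0 : 0 <= x * eps ^+ 2 by rewrite mulr_ge0 // ltW.
  have := ler_wpM2r (ler0n R n) ax; have := ler_wpM2l xe0 half_n; lra.
have budget_le : budget <= nlearn%:R.
  apply: le_trans (ltW (truncnS_gt _)).
  by rewrite ler_peMl ?(le_trans _ budget_ge1) // /oversampling; lra.
have eps4 : eps ^+ 4 <= eps ^+ 2 by apply: ler_wiXn2l => //; apply: ltW.
have : x * budget * eps ^+ 4 <= x * nlearn%:R * eps ^+ 2.
  have budget0 := budget_ge1.
  apply: ler_pM => //; [by apply: mulr_ge0; lra | exact/exprn_ge0/ltW |].
  exact: ler_wpM2l.
have : 0 <= x * nlearn%:R * eps ^+ 2 by rewrite !mulr_ge0 // ltW.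
lra.
Qed.

Let total_ge : oversampling * budget <= ngroups%:R * ngroup%:R.
Proof.
apply: le_trans (ltW (truncnS_gt _)) _; rewrite -/nlearn.
by rewrite -natrM ler_nat ngroups_mul_ge.
Qed.

Let block_ge : oversampling * (budget / L) <= nblock%:R.
Proof. exact/ltW/truncnS_gt. Qed.

Let block_budget_ge : oversampling * n%:R <= nblock%:R * budget * eps ^+ 4.
Proof.
apply: le_trans (_ : oversampling * (budget / L) * budget * eps ^+ 4 <= _).
  have -> : oversampling * (budget / L) * budget * eps ^+ 4 =
      oversampling * (budget * (budget / L) * eps ^+ 4) by ring.
  exact: ler_wpM2l budget_mul_block_ratio_ge.
apply: ler_wpM2r; first exact/exprn_ge0/ltW.
by apply: ler_wpM2r => //; apply: le_trans budget_ge1.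
Qed.

Lemma learn_size_ge :
  oversampling * n%:R <= 2 * (ngroups%:R * ngroup%:R * ngroup%:R * eps ^+ 2).
Proof.
apply: mul_ngroup_ge; first exact: mulr_ge0.
  apply: le_trans (ler_wpM2r (ltW eps2_gt0) total_ge).
  by rewrite -mulrA ler_peMr // (le_trans _ budget_ge).
apply: le_trans (_ : oversampling * (budget * eps ^+ 2) ^+ 2 <= _).
  apply: ler_wpM2l => //; apply: le_trans budget_sqr_ge; exact: ler_peMr.
have -> : oversampling * (budget * eps ^+ 2) ^+ 2 =
    oversampling * budget * budget * eps ^+ 4 by ring.
apply: ler_wpM2r; first exact/exprn_ge0/ltW.
by apply: ler_wpM2r total_ge; apply: le_trans budget_ge1.
Qed.

Lemma block_group_size_ge :
  oversampling * n%:R <= 2 * (nblock%:R * ngroup%:R * eps ^+ 2).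
Proof.
apply: mul_ngroup_ge => //; apply: le_trans (ler_wpM2r (ltW eps2_gt0) block_ge).
by rewrite -mulrA ler_peMr // block_ratio_ge.
Qed.

Lemma block_learn_size_ge :
  oversampling * n%:R <= nblock%:R * (ngroups%:R * ngroup%:R) * eps ^+ 4.
Proof.
apply: le_trans block_budget_ge _; apply: ler_wpM2r; first exact/exprn_ge0/ltW.
apply: ler_wpM2l => //; apply: le_trans total_ge.
by rewrite ler_peMl ?(le_trans _ budget_ge1) // /oversampling; lra.
Qed.

Variable P : 'I_n -> R.
Hypotheses (dP : is_distr P) (farP : eps <= dTV P (unif n)).

Local Notation q := (n%:R^-1 : R).
Local Notation signal := (signal ngroup ngroups P).

Let n_gt0 : 0 < n%:R :> R. Proof. by rewrite ltr0n. Qed.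

Let signal_lower : ngroups%:R * ngroup%:R * q * eps ^+ 2 <= 2 * signal.
Proof. exact: signal_ge dP n0 ngroup_gt0 (geq_minr _ _) eps0 farP. Qed.

Lemma signal_big : 1024 <= ngroup%:R * signal.
Proof.
have := ler_wpM2l (ler0n R ngroup) signal_lower.
move: learn_size_ge; rewrite -ler_pdivlMr // /oversampling; lra.
Qed.

Lemma block_big : 8192 * spread_bound ngroup ngroups P <= nblock%:R * signal ^+ 2.
Proof.
have signal0 : 0 < signal.
  by apply: signal_gt0 farP => //; [exact: ngroup_gt0 | exact: geq_minr].
have group0 : 0 <= ngroup%:R * q by rewrite divr_ge0.
have block_learn :
    64 * 64 * 32 <= nblock%:R * (ngroups%:R * (ngroup%:R * q)) * eps ^+ 4.
  move: block_learn_size_ge; rewrite -ler_pdivlMr // /oversampling; lra.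
have block_group : 64 * 64 * 32 <= nblock%:R * (ngroup%:R * q) * eps ^+ 2.
  move: block_group_size_ge; rewrite -ler_pdivlMr // /oversampling; lra.
have c0 : 0 <= 64 * 64 * 32 :> R by lra.
have := noise_le_sqr_signal c0 (ler0n R nblock) group0 (ler0n R ngroups) (ltW signal0)
  _ block_learn block_group.
rewrite [ngroups%:R * _]mulrA => /(_ signal_lower); rewrite /spread_bound; lra.
Qed.

End SampleSizes.

Theorem theorem3p2 :
  exists C : R, 0 < C /\
  exists A : forall n k : nat, R -> alg n k,
  forall (n k : nat) (eps : R) (P : 'I_n -> R),
    leq 2 k -> leq 1 n -> 0 < eps -> eps <= 1 ->
    is_distr P -> eps <= dTV P (unif n) ->
    (forall b : 'I_k -> bool,
        8 / 9 <= succ_prob (A n k eps) (sources P b) (correct b)) /\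
    (nsamples (A n k eps))%:R <= bound C n k eps.
Proof.
exists (16 * (oversampling + 1)); split; first by rewrite /oversampling; lra.
exists (fun n k eps =>
  classifier n k (ngroups n k eps) (ngroup n k eps) (nblock n k eps) (nvotes k)).
move=> n k eps P k2 n0 eps0 eps1 dP farP; split=> [b|]; last first.
  rewrite boundE; apply: le_trans (nsamples_le n k2 eps0 eps1).
  by rewrite ler_nat nsamples_classifier.
apply: (classifier_correct _ dP n0 _ _ _ _ eps0 farP) => //.
- exact: ngroup_gt0.
- exact: geq_minr.
- exact: signal_big dP farP.
- exact: block_big dP farP.
- exact: nvotes_ge.
Qed.
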